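(* Let $K$ be a totally real cubic number field with ring of integers $\mathcal{O}_K$. If $K\neq\mathbb{Q}(\zeta_7+\zeta_7^{-1})$, then there does not exist a $\mathbb{Z}$-form that is universal over $\mathcal{O}_K$.
   Context: A $\mathbb{Z}$-form is a positive definite quadratic form $Q(x_1,\dots,x_r)=\sum_{1\le i\le j\le r}a_{ij}x_ix_j$ with all $a_{ij}\in\mathbb{Z}$. An element of $\mathcal{O}_K$ is totally positive if its image under each of the three real embeddings of $K$ is positive. A $\mathbb{Z}$-form $Q$ is universal over $\mathcal{O}_K$ if every totally positive $\alpha\in\mathcal{O}_K$ equals $Q(v)$ for some $v\in\mathcal{O}_K^r$. $\zeta_7$ denotes a primitive $7$th root of unity. *)

(* Defs.v *)
From HB Require Import structures.
From mathcomp Require Import all_boot all_order all_algebra all_field.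
Set Implicit Arguments. Unset Strict Implicit. Unset Printing Implicit Defensive.
Import Order.TTheory GRing.Theory Num.Theory.
Local Open Scope ring_scope.

Definition in_OK (L : fieldExtType rat) (x : L) : Prop :=
  exists p : {poly int}, p \is monic /\ root (map_poly (fun z : int => z%:~R : L) p) x.

Definition totally_real (L : fieldExtType rat) : Prop :=
  forall (f : {rmorphism L -> algC}) (x : L), f x \is Creal.

Definition totally_positive (L : fieldExtType rat) (x : L) : Prop :=
  forall f : {rmorphism L -> algC}, 0 < f x.

Definition Qadj (c : algC) (y : algC) : Prop :=
  exists p : {poly rat}, y = (map_poly ratr p).[c].

Definition iso_to_Qadj (L : fieldExtType rat) (c : algC) : Prop :=
  exists f : {rmorphism L -> algC}, forall y, (exists x, f x = y) <-> Qadj c y.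

Definition zform_eval (R : pzRingType) (r : nat) (a : 'I_r -> 'I_r -> int)
  (v : 'I_r -> R) : R :=
  \sum_(i < r) \sum_(j < r | (i <= j)%N) (a i j)%:~R * v i * v j.

(* positive definite (over Q, equivalently over R for rational coefficients) *)
Definition pos_def (r : nat) (a : 'I_r -> 'I_r -> int) : Prop :=
  forall v : 'I_r -> rat, (exists i, v i != 0) -> 0 < zform_eval a v.

Definition universal_over_OK (L : fieldExtType rat) (r : nat)
  (a : 'I_r -> 'I_r -> int) : Prop :=
  forall alpha : L, in_OK alpha -> totally_positive alpha ->
    exists v : 'I_r -> L, (forall i, in_OK (v i)) /\ zform_eval a v = alpha.

(* Main.v *)
(** For [x] in the cubic field [L] let [T x = 3 * Tr (x^2) - Tr (x)^2], a positive definite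
    form on [L] modulo the rationals. Let [y] be an integer outside the rationals minimizing
    [T], and complete [1, y] to a reduced integral basis [1, y, w]. If [alpha = Q(A + B y + C
    w)] with integer vectors [A, B, C], then [3 Tr alpha = Q(u) + Q(B) T(y) + P(B, C) T(y, w)
    + Q(C) T(w)], where [P] is the polar form of [Q] and [u = 3 A + Tr(y) B + Tr(w) C]. Hence
    a nonrational [alpha] represented by [Q] satisfies [3 Tr alpha >= T y]; and if [3 Tr
    alpha] exceeds [T y >= 5] by at most [2], the vectors [B] and [C] are proportional and [4
    alpha] is the square of an integer. A universal [Q] forces this on every totally positive
    integer [k + y] or [k - y]. Normalizing [Tr y] to [0] or [1], some such element has trace
    below [T y / 3] unless the characteristic polynomial of [y] is in a short explicit list.
    In that list only discriminants 49, 81 and 148 are left, and in the last two the square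
    condition fails for an element of norm 3, respectively 5. *)

Require Import Defs.
From HB Require Import structures.
From mathcomp Require Import all_boot all_order all_algebra all_field.
From mathcomp Require Import ring lra zify.
From Stdlib Require Import Classical.
Set Implicit Arguments. Unset Strict Implicit. Unset Printing Implicit Defensive.
Import Order.TTheory GRing.Theory Num.Theory.
Local Open Scope ring_scope.

(** * Embeddings of a cubic field *)

(** The degree of [th] divides the prime 3 and is not 1. *)
Lemma adjoin_cubic (L : fieldExtType rat) (th : L) :
  \dim {: L} = 3%N -> th \notin 1%VS -> adjoin_degree 1%AS th = 3%N /\ <<1; th>>%VS = fullv.
Proof.
move=> dim3 nQth.
have deg3 : adjoin_degree 1%AS th = 3%N.
  have := field_dimS (subvf <<1; th>>%AS); rewrite dim3 dim_Fadjoin dimv1 muln1.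
  move: nQth; rewrite -(adjoin_deg_eq1 1%AS).
  by case: adjoin_degree => [|[|[|[|n]]]] // _ /dvdn_leq.
by split=> //; apply/eqP; rewrite eqEdim subvf dim3 (dim_Fadjoin 1%AS) deg3 dimv1.
Qed.

(** An element is sent to the value at [r] of an arbitrarily chosen polynomial expressing it in
    [th]. Two such polynomials differ by a multiple of [P], which vanishes at [r], so the choice
    does not matter and additivity and multiplicativity follow. *)
Lemma exists_rmorphism_at_root (L : fieldExtType rat) (th : L) (r : algC) (P : {poly rat}) :
  <<1; th>>%VS = fullv ->
  minPoly 1 th = map_poly (in_alg L) P ->
  root (map_poly ratr P) r ->
  exists f : {rmorphism L -> algC},
    forall p : {poly rat}, f (map_poly (in_alg L) p).[th] = (map_poly ratr p).[r].
Proof.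
move=> gen_th DP Pr0.
have surj x : exists p, x == (map_poly (in_alg L) p).[th].
  have /Fadjoin1_polyP[p ->] : x \in <<1; th>>%VS by rewrite gen_th memvf.
  by exists p.
pose f x := (map_poly ratr (xchoose (surj x))).[r].
have fE p : f (map_poly (in_alg L) p).[th] = (map_poly ratr p).[r].
  have /eqP := xchooseP (surj (map_poly (in_alg L) p).[th]).
  rewrite /f; set q := xchoose _ => Eq.
  have : minPoly 1 th %| map_poly (in_alg L) (q - p).
    apply: (@minPoly_dvdp _ _ 1%AS); first exact: alg_polyOver.
    by rewrite rmorphB rootE !hornerE Eq subrr.
  rewrite DP dvdp_map => /dvdpP[s /eqP]; rewrite subr_eq => /eqP->.
  by rewrite rmorphD rmorphM !hornerE (rootP Pr0) mulr0 add0r.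
have polyE x : exists p, x = (map_poly (in_alg L) p).[th].
  by have [p /eqP] := surj x; exists p.
have f_add : zmod_morphism f.
  move=> x y; have [[p ->] [q ->]] := (polyE x, polyE y).
  by rewrite -hornerN -hornerD -rmorphB !fE rmorphB !hornerE.
have f_mul : monoid_morphism f.
  split=> [|x y].
    have -> : 1 = (map_poly (in_alg L) 1).[th] by rewrite rmorph1 hornerE.
    by rewrite fE rmorph1 hornerE.
  have [[p ->] [q ->]] := (polyE x, polyE y).
  by rewrite -hornerM -rmorphM !fE rmorphM hornerM.
pose fA := GRing.isZmodMorphism.Build _ _ f f_add.
pose fM := GRing.isMonoidMorphism.Build _ _ f f_mul.
pose F : {rmorphism L -> algC} := HB.pack f fA fM.
by exists F.
Qed.

(** A generator is sent to each of the three roots of its minimal polynomial. Every element is a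
    polynomial of degree at most 2 in the generator, so the sum of its images is a symmetric
    function of the roots, hence rational. *)
Lemma three_embeddings (L : fieldExtType rat) : \dim {: L} = 3%N ->
  exists c1 c2 c3 : {rmorphism L -> algC}, forall x, c1 x + c2 x + c3 x \in Crat.
Proof.
move=> dim3.
have [th nQth] : exists th : L, th \notin 1%VS.
  have /subvPn[th _ nth] : ~~ ({:L} <= 1)%VS.
    by apply/negP=> /dimvS; rewrite dim3 dimv1.
  by exists th.
have [deg3 gen_th] := adjoin_cubic dim3 nQth.
have /polyOver1P[P DP] := minPolyOver 1%AS th.
have sP : size P = 4%N.
  by rewrite -(size_map_poly (in_alg L)) -DP (size_minPoly 1%AS) deg3.
have monP : P \is monic by rewrite -(map_monic (in_alg L)) -DP monic_minPoly.
have [rs Drs] := closed_field_poly_normal (map_poly ratr P : {poly algC}).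
move: Drs; rewrite (monicP _) ?map_monic // scale1r => Drs.
have: size rs = 3%N.
  by apply/eqP; rewrite -eqSS -(size_prod_XsubC _ id) -Drs size_map_poly sP.
case: rs Drs => [|r1 [|r2 [|r3 []]]] // Drs _.
have rootP' r : r \in [:: r1; r2; r3] -> root (map_poly ratr P) r.
  by rewrite Drs root_prod_XsubC.
have emb r (h : r \in [:: r1; r2; r3]) := exists_rmorphism_at_root gen_th DP (rootP' r h).
have [c1 Dc1] := emb r1 ltac:(by rewrite !inE eqxx).
have [c2 Dc2] := emb r2 ltac:(by rewrite !inE eqxx orbT).
have [c3 Dc3] := emb r3 ltac:(by rewrite !inE eqxx !orbT).
exists c1, c2, c3 => x.
have /polyOver1P[p Dp] := Fadjoin_polyOver 1%AS th x.
have Dx : x = (map_poly (in_alg L) p).[th].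
  by rewrite -Dp Fadjoin_poly_eq // gen_th memvf.
have sp : (size p <= 3)%N.
  by rewrite -(size_map_poly (in_alg L)) -Dp -deg3 size_Fadjoin_poly.
rewrite Dx Dc1 Dc2 Dc3.
have hE (r : algC) : (map_poly ratr p).[r] = ratr p`_0 + ratr p`_1 * r + ratr p`_2 * r ^+ 2 :> algC.
  rewrite (@horner_coef_wide _ 3%N) ?size_map_poly // !big_ord_recr big_ord0 /=.
  by rewrite !coef_map /= add0r expr0 mulr1 expr1.
have eval (x0 : algC) : (map_poly ratr P).[x0] = (x0 - r1) * (x0 - r2) * (x0 - r3).
  by rewrite Drs !big_cons big_nil mulr1 mulrA !hornerM !hornerXsubC.
have evalP (x0 : algC) : (map_poly ratr P).[x0] =
    ratr P`_0 + ratr P`_1 * x0 + ratr P`_2 * x0 ^+ 2 + x0 ^+ 3.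
  have lcP : P`_3 = 1 by move/monicP: monP; rewrite /lead_coef sP.
  rewrite (@horner_coef_wide _ 4%N) ?size_map_poly ?sP // !big_ord_recr big_ord0 /=.
  by rewrite !coef_map /= lcP rmorph1 mul1r add0r expr0 mulr1 expr1.
have n2 : (2 : algC) != 0 by rewrite pnatr_eq0.
(* The function [g] vanishes identically and has degree at most 2 in [x0]; its values at 0, 1 and -1
   isolate the two Vieta relations. *)
pose g (x0 : algC) := ratr P`_0 + ratr P`_1 * x0 + ratr P`_2 * x0 ^+ 2 + x0 ^+ 3
    - (x0 - r1) * (x0 - r2) * (x0 - r3).
have g0 x0 : g x0 = 0 by rewrite /g -evalP eval subrr.
have S1 : r1 + r2 + r3 = - ratr P`_2 :> algC.
  apply/(mulfI n2)/subr0_eq.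
  transitivity (g 1 + g (-1) - 2 * g 0); first by rewrite /g; ring.
  by rewrite !g0 mulr0 !addr0 subr0.
have S2 : r1 * r2 + r1 * r3 + r2 * r3 = ratr P`_1 :> algC.
  apply/(mulfI n2)/subr0_eq.
  transitivity (g (-1) - g 1); first by rewrite /g; ring.
  by rewrite !g0 subr0.
rewrite !hE.
have -> : ratr p`_0 + ratr p`_1 * r1 + ratr p`_2 * r1 ^+ 2
        + (ratr p`_0 + ratr p`_1 * r2 + ratr p`_2 * r2 ^+ 2)
        + (ratr p`_0 + ratr p`_1 * r3 + ratr p`_2 * r3 ^+ 2)
        = 3 * ratr p`_0 + ratr p`_1 * - ratr P`_2
          + ratr p`_2 * (ratr P`_2 ^+ 2 - 2 * ratr P`_1).
  rewrite -S2 -[ratr P`_2]opprK -S1; ring.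
by do ?[exact: Crat_rat | exact: rpred_nat | rewrite rpredN
  | apply: rpredD | apply: rpredM | apply: rpredX].
Qed.

(** * The trace form *)

(** Well-ordering for an undecidable predicate, hence the classical case split. *)
Lemma exists_minimizer (X : Type) (P : X -> Prop) (m : X -> nat) :
  (exists x, P x) -> exists2 x, P x & forall z, P z -> (m x <= m z)%N.
Proof.
case=> x Px; have [n] := ubnP (m x); elim: n => // n IHn in x Px * => /ltnSE-le_n.
have [[z [Pz lt_zx]] | noz] := classic (exists z, P z /\ (m z < m x)%N).
  by apply: (IHn z) => //; apply: leq_trans lt_zx le_n.
by exists x => // z Pz; rewrite leqNgt; apply/negP=> lt_zx; case: noz; exists z.
Qed.

Lemma ratr_algC_inj : injective (ratr : rat -> algC).
Proof. exact: fmorph_inj. Qed.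

(** Rationality of the sums suffices: applied to powers, it makes all symmetric functions of the
    conjugates rational. *)
Record conjugates (L : fieldExtType rat) := Conjugates {
  conj1 : {rmorphism L -> algC};
  conj2 : {rmorphism L -> algC};
  conj3 : {rmorphism L -> algC};
  conj_sum_rat : forall x, conj1 x + conj2 x + conj3 x \in Crat
}.

Section Trace.

Variables (L : fieldExtType rat) (s : conjugates L).
Implicit Types x z : L.

Definition tr x : rat := getCrat (conj1 s x + conj2 s x + conj3 s x).

Lemma ratr_tr x : ratr (tr x) = conj1 s x + conj2 s x + conj3 s x.
Proof. exact/getCratK/conj_sum_rat. Qed.

Lemma trD x z : tr (x + z) = tr x + tr z.
Proof. by apply: ratr_algC_inj; rewrite rmorphD /= !ratr_tr !rmorphD; ring. Qed.

Lemma trZ (a : rat) x : tr (a *: x) = a * tr x.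
Proof.
apply: ratr_algC_inj; rewrite [RHS]rmorphM /= !ratr_tr !rmorphZ_num; ring.
Qed.

Lemma tr1 : tr 1 = 3.
Proof. by apply: ratr_algC_inj; rewrite ratr_tr !rmorph1 rmorph_nat; ring. Qed.

Definition trform x z : rat := 3 * tr (x * z) - tr x * tr z.

Lemma trformDl x1 x2 z : trform (x1 + x2) z = trform x1 z + trform x2 z.
Proof. by rewrite /trform (mulrDl x1) !trD; ring. Qed.

Lemma trformZl (a : rat) x z : trform (a *: x) z = a * trform x z.
Proof. by rewrite /trform -scalerAl !trZ; ring. Qed.

Lemma trformC x z : trform x z = trform z x.
Proof. by rewrite /trform (mulrC x) (mulrC (tr x)). Qed.

Lemma trform1l z : trform 1 z = 0.
Proof. by rewrite /trform mul1r tr1 subrr. Qed.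

Lemma trform_comb (a b : rat) x z :
  trform (a *: x + b *: z) (a *: x + b *: z)
  = a ^+ 2 * trform x x + 2 * a * b * trform x z + b ^+ 2 * trform z z.
Proof.
rewrite !(trformDl, trformZl) ![trform _ (_ + _)]trformC !(trformDl, trformZl) (trformC z x).
ring.
Qed.

Lemma trform_addC (a : rat) x z : trform (a%:A + x) (a%:A + z) = trform x z.
Proof.
rewrite trformDl trformZl trform1l mulr0 add0r trformC.
by rewrite trformDl trformZl trform1l mulr0 add0r trformC.
Qed.

Lemma ratr_trform x :
  ratr (trform x x) = (conj1 s x - conj2 s x) ^+ 2 + (conj1 s x - conj3 s x) ^+ 2
                      + (conj2 s x - conj3 s x) ^+ 2.
Proof. by rewrite rmorphB !rmorphM /= !ratr_tr rmorph_nat !rmorphM; ring. Qed.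

Lemma trform_ge0 x : totally_real L -> 0 <= trform x x.
Proof.
move=> realL; rewrite -(ler_rat algC) rmorph0 ratr_trform.
by rewrite !addr_ge0 // -realEsqr rpredB ?realL.
Qed.

(** If the sum of squared differences vanishes, the three conjugates coincide and [x] equals a third
    of its trace. *)
Lemma trform_gt0 x : totally_real L -> x \notin 1%VS -> 0 < trform x x.
Proof.
move=> realL nQx; rewrite lt_neqAle trform_ge0 // andbT eq_sym.
apply: contra nQx => /eqP/(congr1 (@ratr algC)); rewrite rmorph0 ratr_trform.
have sq_ge0 (f g : {rmorphism L -> algC}) : 0 <= (f x - g x) ^+ 2.
  by rewrite -realEsqr rpredB ?realL.
move/eqP; rewrite paddr_eq0 ?addr_ge0 // paddr_eq0 // !sqrf_eq0 !subr_eq0.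
case/andP=> /andP[/eqP e12 /eqP e13] _.
have -> : x = (tr x / 3)%:A; last by rewrite rpredZ ?mem1v.
apply: (fmorph_inj (conj1 s)); rewrite rmorphZ_num rmorph1 mulr1.
rewrite fmorph_div /= ratr_tr -e12 -e13 rmorph_nat.
by field.
Qed.

(** The characteristic polynomial of [x] is [X^3 - t X^2 + q X - n], recorded by the elementary
    symmetric functions of the conjugates. *)
Definition vieta x (t q n : rat) : Prop :=
  [/\ conj1 s x + conj2 s x + conj3 s x = ratr t,
      conj1 s x * conj2 s x + conj1 s x * conj3 s x + conj2 s x * conj3 s x = ratr q
    & conj1 s x * conj2 s x * conj3 s x = ratr n].

(** Newton's identities express these coefficients by the traces of [x], [x^2] and [x^3]. *)
Lemma exists_vieta x : exists t q n, vieta x t q n.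
Proof.
have pow k : exists a, conj1 s x ^+ k + conj2 s x ^+ k + conj3 s x ^+ k = ratr a.
  by exists (tr (x ^+ k)); rewrite ratr_tr !rmorphXn.
have [a1 Da1] := pow 1%N; have [a2 Da2] := pow 2%N; have [a3 Da3] := pow 3%N.
pose q := (a1 ^+ 2 - a2) / 2; exists a1, q, ((a3 - a1 ^+ 3 + 3 * a1 * q) / 3).
rewrite /vieta /q
  !(fmorph_div, rmorphB, rmorphD, rmorphM, rmorphXn) /= -Da1 -Da2 -Da3 rmorph1.
by split; field.
Qed.

Lemma vieta_tr x t q n : vieta x t q n -> tr x = t.
Proof. by case=> Dt _ _; apply: ratr_algC_inj; rewrite ratr_tr. Qed.

Lemma vieta_trform x t q n : vieta x t q n -> trform x x = 2 * t ^+ 2 - 6 * q.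
Proof.
case=> Dt Dq _; apply: ratr_algC_inj; rewrite ratr_trform.
by rewrite rmorphB !rmorphM /= -Dt -Dq !rmorph_nat; ring.
Qed.

Lemma vieta_root x t q n : vieta x t q n ->
  x ^+ 3 - t *: x ^+ 2 + q *: x - n%:A = 0.
Proof.
case=> Dt Dq Dn; apply: (fmorph_inj (conj1 s)).
rewrite rmorph0 !(rmorphB, rmorphD, rmorphN) /= !rmorphZ_num rmorph1 !rmorphXn /= -Dt -Dq -Dn.
by ring.
Qed.

(** The image [f x] is a root of the characteristic polynomial, which splits into the conjugates.
    This reduces a statement about all embeddings to the three in [s]. *)
Lemma conjP (f : {rmorphism L -> algC}) x :
  [\/ f x = conj1 s x, f x = conj2 s x | f x = conj3 s x].
Proof.
have [t [q [n Dx]]] := exists_vieta x; have := congr1 f (vieta_root Dx).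
rewrite rmorph0 !(rmorphB, rmorphD, rmorphN) /= !rmorphZ_num rmorph1 !rmorphXn.
case: Dx => <- <- <- /eqP.
set u := conj1 s x; set v := conj2 s x; set w := conj3 s x.
have -> : f x ^+ 3 - (u + v + w) * f x ^+ 2 + (u * v + u * w + v * w) * f x - u * v * w * 1
  = (f x - u) * (f x - v) * (f x - w) by ring.
rewrite !mulf_eq0 !subr_eq0 -orbA => /or3P[] /eqP->.
- exact: Or31.
- exact: Or32.
- exact: Or33.
Qed.

End Trace.

(** * Algebraic integers of the field *)

Section Integers.

Variable L : fieldExtType rat.
Implicit Types x z : L.

Lemma in_OKE x : in_OK x <-> integralOver (intr : int -> L) x.
Proof. by split=> [[p [mon_p px]]|[p mon_p px]]; exists p. Qed.

Lemma in_OKD x z : in_OK x -> in_OK z -> in_OK (x + z).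
Proof. by move=> /in_OKE Ox /in_OKE Oz; apply/in_OKE; apply: integral_add. Qed.

Lemma in_OKM x z : in_OK x -> in_OK z -> in_OK (x * z).
Proof. by move=> /in_OKE Ox /in_OKE Oz; apply/in_OKE; apply: integral_mul. Qed.

Lemma in_OK_int (a : int) : in_OK (a%:~R : L).
Proof. by apply/in_OKE; apply: integral_id. Qed.

Lemma in_OKZ (a : int) x : in_OK x -> in_OK (a%:~R * x).
Proof. by move=> Ox; apply: in_OKM => //; apply: in_OK_int. Qed.

Lemma in_OK_cubic (t q n : int) x :
  x ^+ 3 - t%:~R * x ^+ 2 + q%:~R * x - n%:~R = 0 -> in_OK x.
Proof.
move=> Dx; exists (Poly [:: - n; q; - t; 1]); split.
  by rewrite monicE /lead_coef (PolyK (c := 0)).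
rewrite rootE (map_Poly (intr : {rmorphism int -> L})) horner_Poly /=.
by apply/eqP; rewrite -[RHS]Dx !rmorphN rmorph1 /=; ring.
Qed.

Lemma in_OK_Aint (f : {rmorphism L -> algC}) x : in_OK x -> f x \in Aint.
Proof.
move=> [p [mon_p px]]; apply: (@root_monic_Aint (map_poly intr p)).
- have -> : map_poly intr p = map_poly f (map_poly (intr : int -> L) p).
    by rewrite -map_poly_comp; apply: eq_map_poly => a /=; rewrite rmorph_int.
  by rewrite fmorph_root.
- exact: monic_map.
- by apply/polyOverP=> i; rewrite coef_map /= rpred_int.
Qed.

Lemma ratr_Aint (a : rat) : ratr a \in Aint -> exists m : int, a = m%:~R.
Proof.
move=> Aa; have /intrP[m Dm] := Cint_rat_Aint (Crat_rat a) Aa.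
by exists m; apply: ratr_algC_inj; rewrite Dm rmorph_int.
Qed.

Lemma in_OK_rat (f : {rmorphism L -> algC}) (a : rat) :
  in_OK (a%:A : L) -> exists m : int, a = m%:~R.
Proof. by move/(in_OK_Aint f); rewrite rmorphZ_num rmorph1 mulr1 => /ratr_Aint. Qed.

Lemma in_OK_vieta (s : conjugates L) x : in_OK x ->
  exists t q n : int, vieta s x t%:~R q%:~R n%:~R.
Proof.
move=> Ox; have Ac f := in_OK_Aint f Ox.
have [t [q [n [Dt Dq Dn]]]] := exists_vieta s x.
have [t' Dt'] : exists m : int, t = m%:~R by apply: ratr_Aint; rewrite -Dt !rpredD.
have [q' Dq'] : exists m : int, q = m%:~R.
  by apply: ratr_Aint; rewrite -Dq !rpredD // rpredM.
have [n' Dn'] : exists m : int, n = m%:~R by apply: ratr_Aint; rewrite -Dn !rpredM.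
by exists t', q', n'; rewrite -Dt' -Dq' -Dn'.
Qed.

Lemma rat_denom (a : rat) : exists2 d : int, d != 0 & exists m : int, a * d%:~R = m%:~R.
Proof.
exists (denq a); first exact: denq_neq0.
by exists (numq a); rewrite -{1}(divq_num_den a) divfK // intr_eq0 denq_neq0.
Qed.

Lemma exists_integral_multiple (s : conjugates L) x :
  exists2 d : int, d != 0 & in_OK (d%:~R * x).
Proof.
have [t [q [n /vieta_root Dx]]] := exists_vieta s x.
have [d1 nz1 [m1 E1]] := rat_denom t; have [d2 nz2 [m2 E2]] := rat_denom q.
have [d3 nz3 [m3 E3]] := rat_denom n.
exists (d1 * d2 * d3); first by rewrite !mulf_neq0.
(* Multiplying [x] by [d] multiplies the coefficients [t], [q], [n] by [d], [d^2], [d^3], which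
   clears their denominators. *)
apply: (@in_OK_cubic (m1 * d2 * d3) (m2 * d2 * d1 ^+ 2 * d3 ^+ 2)
          (m3 * d1 ^+ 3 * d2 ^+ 3 * d3 ^+ 2)).
have F (a : rat) d m : a * d%:~R = m%:~R -> m%:~R = a%:A * d%:~R :> L.
  by move=> E; rewrite -(rmorph_int (in_alg L) m) -E rmorphM rmorph_int.
rewrite !(intrM, rmorphXn) /= (F _ _ _ E1) (F _ _ _ E2) (F _ _ _ E3).
have {Dx} : x ^+ 3 - t%:A * x ^+ 2 + q%:A * x - n%:A = 0 by rewrite -Dx !mulr_algl.
move: t%:A q%:A n%:A (d1%:~R : L) (d2%:~R : L) (d3%:~R : L) => T Q N e1 e2 e3 {}Dx.
transitivity ((e1 * e2 * e3) ^+ 3 * (0 : L)); last exact: mulr0.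
by rewrite -Dx; ring.
Qed.

End Integers.

(** * Successive minima of the trace form and reduced integral bases *)

Section Reduction.

Variables (L : fieldExtType rat) (s : conjugates L).
Hypothesis (realL : totally_real L).
Implicit Types (x y z w : L) (U : {vspace L}).
Local Notation T := (trform s).

Lemma trform_nat x : in_OK x -> exists k : nat, T x x = k%:R.
Proof.
move=> /(in_OK_vieta s)[t [q [n Dx]]]; have := trform_ge0 s x realL.
rewrite (vieta_trform Dx) -(intrM _ 6 q) -rmorphXn -(intrM _ 2 (t ^+ 2)) -intrB ler0z.
by case: (_ - _) => // k _; exists k.
Qed.

(** On integers [T] takes natural values, and some integer lies outside [U] because every element
    has a nonzero integral multiple. The rationals as [U] give [y]; then their span with [y] gives
    [w]. *)
Lemma exists_trform_minimizer U : ~~ ({:L} <= U)%VS ->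
  exists y, [/\ in_OK y, y \notin U & forall z, in_OK z -> z \notin U -> T y y <= T z z].
Proof.
move=> /subvPn[x _ nUx].
have [|y [Oy nUy] min_y] := @exists_minimizer _ (fun z => in_OK z /\ z \notin U)
    (fun z => `|Num.floor (T z z)|%N).
  have [d nz_d Odx] := exists_integral_multiple s x.
  exists (d%:~R * x); split=> //; apply: contra nUx => Udx.
  have := memvZ (d%:~R^-1) Udx.
  by rewrite -(rmorph_int (in_alg L)) mulr_algl scalerA mulVf ?scale1r // intr_eq0.
exists y; split=> // z Oz nUz; have {min_y} := min_y z (conj Oz nUz).
have [[k ->] [m ->]] := (trform_nat Oy, trform_nat Oz).
by rewrite !pmulrn !intrKfloor ler_int.
Qed.

Lemma dimv_addv_line U x : x \notin U -> (\dim U < \dim (U + <[x]>))%N.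
Proof.
apply: contraR; rewrite -leqNgt => le_dim.
have /eqP-> : U == (U + <[x]>)%VS by rewrite eqEdim addvSl.
by rewrite memvE addvSr.
Qed.


Lemma nearest_int (a : rat) : exists m : int, `|a - m%:~R| <= 2^-1.
Proof.
exists (Num.floor (a + 2^-1)); have /andP[] := floor_itv (a + 2^-1).
rewrite intrD ler_norml; set m := _%:~R => *; apply/andP; split; lra.
Qed.

(** The three terms are at most [a / 4], [a / 4] and [c / 4]. Thus a remainder after rounding
    coordinates is strictly shorter than the second basis vector. *)
Lemma reduced_form_le (a b c u v : rat) :
  a <= c -> 2 * `|b| <= a -> `|u| <= 2^-1 -> `|v| <= 2^-1 ->
  u ^+ 2 * a + 2 * u * v * b + v ^+ 2 * c <= 3 / 4 * c.
Proof.
move=> le_ac; rewrite -ler_pdivlMl // !ler_norml => /andP[b1 b2] /andP[u1 u2] /andP[v1 v2].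
have a_ge0 : 0 <= a by lra.
have su : u ^+ 2 <= 1 / 4 by nra.
have sv : v ^+ 2 <= 1 / 4 by nra.
have [uv1 uv2] : - (1 / 2) <= 2 * u * v /\ 2 * u * v <= 1 / 2 by split; nra.
have : 2 * u * v * b <= a / 4 by move: (2 * u * v) uv1 uv2 => w *; nra.
have : u ^+ 2 * a <= a / 4 by nra.
have : v ^+ 2 * c <= c / 4 by nra.
lra.
Qed.

(** Take [w] minimal outside the span of 1 and [y]. Rounding the coordinates of an integer leaves a
    remainder too short to lie outside this span, and then too short to be nonrational. *)
Lemma exists_reduced_basis y : \dim {:L} = 3%N -> in_OK y -> y \notin 1%VS ->
  (forall z, in_OK z -> z \notin 1%VS -> T y y <= T z z) ->
  exists w, [/\ in_OK w, w \notin (1 + <[y]>)%VS, T y y <= T w w, 2 * `|T y w| <= T y y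
    & forall z, in_OK z -> exists a b c : int, z = a%:~R + b%:~R * y + c%:~R * w].
Proof.
move=> dim3 Oy nQy min_y; set U := (1 + <[y]>)%VS.
have sQU : (1 <= U)%VS by apply: addvSl.
have Uy : y \in U by rewrite memvE addvSr.
have [|w [Ow nUw min_w]] := @exists_trform_minimizer U.
  apply/negP=> /dimvS; apply/negP; rewrite dim3 -ltnNge.
  by rewrite (leq_ltn_trans (dimv_add_leqif _ _)) // dimv1 dim_vline; case: (y != 0).
have nQw : w \notin 1%VS by apply: contra nUw; apply: (subvP sQU).
have dimU : (1 < \dim U)%N by have := dimv_addv_line nQy; rewrite dimv1.
have full : (U + <[w]>)%VS = fullv.
  by apply/eqP; rewrite eqEdim subvf dim3; apply: leq_ltn_trans (dimv_addv_line nUw).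
have le_yw := min_y w Ow nQw.
(* Comparing [w] with [w + y] and [w - y] bounds [T y w]. *)
have shift (e : int) : T w w <= e%:~R ^+ 2 * T y y + 2 * e%:~R * T y w + T w w.
  have := min_w (w + e%:~R * y) (in_OKD Ow (in_OKZ e Oy)).
  rewrite -(rmorph_int (in_alg L)) mulr_algl.
  have -> : w + e%:~R *: y = e%:~R *: y + 1 *: w by rewrite scale1r addrC.
  rewrite trform_comb mulr1 expr1n mul1r; apply.
  apply: contra nUw; rewrite scale1r rpredDl //; exact: memvZ.
have le_yw2 : 2 * `|T y w| <= T y y.
  have := shift 1; have := shift (-1); rewrite -ler_pdivlMl // ler_norml.
  by rewrite rmorphN1 sqrrN expr1n => *; apply/andP; split; lra.
exists w; split=> // z Oz.
have /memv_addP[_ /memv_addP[_ /vlineP[a ->] [_ /vlineP[b ->] ->]] [_ /vlineP[c ->] Dz]] :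
  z \in (U + <[w]>)%VS by rewrite full memvf.
have [[mb near_b] [mc near_c]] := (nearest_int b, nearest_int c).
pose z' := z - mb%:~R * y - mc%:~R * w.
have Oz' : in_OK z'.
  rewrite /z' -!mulNr -!rmorphN.
  exact: in_OKD (in_OKD Oz (in_OKZ _ Oy)) (in_OKZ _ Ow).
pose b' := b - mb%:~R; pose c' := c - mc%:~R.
have Dz' : z' = a%:A + (b' *: y + c' *: w).
  rewrite /z' Dz !scalerBl -!(rmorph_int (in_alg L)) !mulr_algl.
  by move: (_ *: _) (_ *: _) (_ *: _) (_ *: _) (_ *: _) => *; ring.
have Tz' : T z' z' = b' ^+ 2 * T y y + 2 * b' * c' * T y w + c' ^+ 2 * T w w.
  by rewrite Dz' trform_addC trform_comb.
have Tw_gt0 := trform_gt0 s realL nQw; have Ty_gt0 := trform_gt0 s realL nQy.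
have Uz' : z' \in U.
  apply: contraT => /(min_w _ Oz'); rewrite Tz' => le_w.
  have := reduced_form_le le_yw le_yw2 near_b near_c; rewrite -/b' -/c' => le_34.
  clear -le_w le_34 Tw_gt0; lra.
have c'0 : c' = 0.
  apply/eqP; apply: contraR nUw => nz_c'.
  have : c' *: w \in U.
    have -> : c' *: w = z' - a%:A - b' *: y.
      by rewrite Dz'; move: (_ *: _) (_ *: _) (_ *: _) => *; ring.
    apply: rpredB; [apply: rpredB => //; apply: (subvP sQU) | exact: memvZ].
    by rewrite memvZ ?mem1v.
  by move/(memvZ c'^-1); rewrite scalerA mulVf ?scale1r.
have b'0 : b' = 0.
  apply/eqP; apply: contraT => nz_b'.
  have : T y y <= T z' z'.
    apply: min_y => //; apply: contra nQy => Qz'.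
    have : b' *: y \in 1%VS.
      have -> : b' *: y = z' - a%:A by rewrite Dz' c'0 scale0r addr0 addrC addKr.
      by rewrite rpredB ?rpredZ ?mem1v.
    by move/(memvZ b'^-1); rewrite scalerA mulVf ?scale1r.
  rewrite Tz' c'0; move: near_b; rewrite -/b' ler_norml => /andP[b_ge b_le] le_yz.
  clear -b_ge b_le le_yz Ty_gt0.
  have : b' ^+ 2 <= 1 / 4 by nra.
  nra.
have [ma Dma] : exists m : int, a = m%:~R.
  apply: (in_OK_rat (conj1 s)).
  by move: Oz'; rewrite Dz' b'0 c'0 !scale0r !addr0.
exists ma, mb, mc; rewrite Dz Dma.
have -> : b = mb%:~R by apply/eqP; rewrite -subr_eq0 -/b' b'0.
have -> : c = mc%:~R by apply/eqP; rewrite -subr_eq0 -/c' c'0.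
by rewrite -!(rmorph_int (in_alg L)) !mulr_algl.
Qed.

End Reduction.

(** * Integral forms evaluated at algebraic integers *)

Section Forms.

Variables (r : nat) (a : 'I_r -> 'I_r -> int).

(** The polarization [Q (u + v) - Q u - Q v]. *)
Definition polar (R : pzRingType) (u v : 'I_r -> R) : R :=
  \sum_(i < r) \sum_(j < r | (i <= j)%N) (a i j)%:~R * (u i * v j + v i * u j).

Lemma zform_comb (R : comPzRingType) (u v w : 'I_r -> R) (x y z : R) :
  zform_eval a (fun i => u i * x + v i * y + w i * z) =
  zform_eval a u * x ^+ 2 + zform_eval a v * y ^+ 2 + zform_eval a w * z ^+ 2
  + polar u v * (x * y) + polar u w * (x * z) + polar v w * (y * z).
Proof.
rewrite /zform_eval /polar !mulr_suml -!big_split /=; apply: eq_bigr => i _.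
rewrite !mulr_suml -!big_split /=; apply: eq_bigr => j _; ring.
Qed.

Lemma zform_intr (R : pzRingType) (u : 'I_r -> int) :
  zform_eval a (fun i => (u i)%:~R) = (zform_eval a u)%:~R :> R.
Proof.
rewrite /zform_eval rmorph_sum; apply: eq_bigr => i _.
by rewrite rmorph_sum; apply: eq_bigr => j _; rewrite !rmorphM /= intz.
Qed.

Lemma polar_intr (R : pzRingType) (u v : 'I_r -> int) :
  polar (fun i => (u i)%:~R) (fun i => (v i)%:~R) = (polar u v)%:~R :> R.
Proof.
rewrite /polar rmorph_sum; apply: eq_bigr => i _.
by rewrite rmorph_sum; apply: eq_bigr => j _; rewrite !(rmorphM, rmorphD) /= intz.
Qed.

Lemma eq_zform (R : pzRingType) (u v : 'I_r -> R) :
  u =1 v -> zform_eval a u = zform_eval a v.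
Proof.
by move=> e; apply: eq_bigr => i _; apply: eq_bigr => j _; rewrite !e.
Qed.

Hypothesis posQ : pos_def a.

Lemma zform_ge1 (u : 'I_r -> int) : ~~ [forall i, u i == 0] -> 1 <= zform_eval a u.
Proof.
rewrite negb_forall => /existsP[i nz_i].
have := posQ (v := fun i => (u i)%:~R); rewrite zform_intr ltr0z; apply.
by exists i; rewrite intr_eq0.
Qed.

Lemma zform_ge0 (u : 'I_r -> int) : 0 <= zform_eval a u.
Proof.
have [/forallP u0 | /zform_ge1] := boolP [forall i, u i == 0]; last exact: le_trans.
rewrite /zform_eval big1 // => i _; rewrite big1 // => j _.
by rewrite (eqP (u0 i)) mulr0 mul0r.
Qed.

End Forms.

(* The trace of the product of the Gram matrices of [B, C] and of [y, w]: bounding it below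
   uses only that [Q (B + C)] and [Q (B - C)] are nonzero integers. *)
Lemma reduced_tensor_ge (q0 q1 q2 p b t c : rat) :
  0 <= q0 -> 1 <= q1 -> 1 <= q2 -> 1 <= q1 + p + q2 -> 1 <= q1 - p + q2 ->
  0 < b -> b <= c -> 2 * `|t| <= b -> 3 / 2 * b <= q0 + q1 * b + p * t + q2 * c.
Proof.
move=> q0_ge q1_ge q2_ge pl pr b_gt le_bc.
rewrite -ler_pdivlMl // ler_norml => /andP[t1 t2].
(* Half the sum of the first two products bounds [p * t] below by [- (q1 + q2 - 1) * b / 2]; the
   other two replace [c] by [b] and [q1 + q2] by 2. *)
have : 0 <= (q1 + q2 - 1 + p) * (2^-1 * b + t) by rewrite mulr_ge0 //; lra.
have : 0 <= (q1 + q2 - 1 - p) * (2^-1 * b - t) by rewrite mulr_ge0 //; lra.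
have : 0 <= q2 * (c - b) by rewrite mulr_ge0 //; lra.
have : 0 <= (q1 + q2 - 2) * b by rewrite mulr_ge0 //; lra.
lra.
Qed.

(** * Traces of the elements represented by a form *)

Section Representation.

Variables (L : fieldExtType rat) (s : conjugates L).
Variables (r : nat) (a : 'I_r -> 'I_r -> int).
Hypotheses (realL : totally_real L) (posQ : pos_def a).
Implicit Types (x y z w alpha : L) (A B C : 'I_r -> int).
Local Notation T := (trform s).
Local Notation Q := (zform_eval a).
Local Notation P := (polar a).

Lemma tr_int (m : int) : tr s m%:~R = 3 * m%:~R.
Proof. by rewrite -(rmorph_int (in_alg L)) trZ tr1 mulrC. Qed.

Lemma trM_int (m : int) x : tr s (m%:~R * x) = m%:~R * tr s x.
Proof. by rewrite -(rmorph_int (in_alg L)) mulr_algl trZ. Qed.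

Lemma in_OK_tr x : in_OK x -> exists m : int, tr s x = m%:~R.
Proof. by move=> /(in_OK_vieta s)[t [q [n /vieta_tr->]]]; exists t. Qed.

Lemma zform_integral_comb A B C y w :
  zform_eval a (fun i => (A i)%:~R + (B i)%:~R * y + (C i)%:~R * w) =
  (Q A)%:~R + (Q B)%:~R * y ^+ 2 + (Q C)%:~R * w ^+ 2
  + (P A B)%:~R * y + (P A C)%:~R * w + (P B C)%:~R * (y * w).
Proof.
have := zform_comb a (fun i => (A i)%:~R) (fun i => (B i)%:~R) (fun i => (C i)%:~R) 1 y w.
rewrite !zform_intr !polar_intr expr1n !mulr1 !mul1r => <-.
by apply: eq_zform => i; rewrite mulr1.
Qed.

(** The vector inside the first [Q] consists of the traces of the coordinates; the identity is
    [3 Tr (x z) = T x z + Tr x Tr z], extended over the terms of the form. *)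
Lemma tr_zform_integral_comb A B C y w (ty tw : int) :
  tr s y = ty%:~R -> tr s w = tw%:~R ->
  3 * tr s (zform_eval a (fun i => (A i)%:~R + (B i)%:~R * y + (C i)%:~R * w)) =
  (Q (fun i => A i * 3 + B i * ty + C i * tw))%:~R
  + (Q B)%:~R * T y y + (P B C)%:~R * T y w + (Q C)%:~R * T w w.
Proof.
move=> Dy Dw; rewrite zform_integral_comb zform_comb !trD tr_int !trM_int /trform.
rewrite !(intrD, intrM) ?rmorphXn /= Dy Dw !expr2; ring.
Qed.


(** Here [3 Tr alpha = Q u + Q B * T z] with [u] the traces of the coordinates. A trace this small
    forces [Q B = 1] and [Q u <= 2], so the binary form [Q] on [A, B] degenerates and [alpha]
    becomes a square up to the factor 4. *)
Lemma short_rank1_square A B z (m : rat) alpha :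
  in_OK z -> m <= T z z -> alpha \notin 1%VS ->
  alpha = zform_eval a (fun i => (A i)%:~R + (B i)%:~R * z) ->
  m <= 3 * tr s alpha /\
  (5 <= m -> 3 * tr s alpha <= m + 2 -> exists2 x, in_OK x & 4 * alpha = x ^+ 2).
Proof.
move=> Oz le_mT nQalpha Dalpha; have [t Dt] := in_OK_tr Oz.
have E1 : alpha = (Q A)%:~R + (Q B)%:~R * z ^+ 2 + (P A B)%:~R * z.
  have := zform_integral_comb A B (fun=> 0) z 0.
  move=> E; rewrite Dalpha; transitivity (Q (fun i => (A i)%:~R + (B i)%:~R * z + 0%:~R * 0)).
    by apply: eq_zform => i; rewrite mulr0 addr0.
  by rewrite E; ring.
pose u i := A i * 3 + B i * t.
have Qu : Q u = 9 * Q A + t ^+ 2 * Q B + 3 * t * P A B.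
  have := zform_comb a A B (fun=> 0) 3 t 0.
  move=> E; transitivity (Q (fun i => A i * 3 + B i * t + 0 * 0)).
    by apply: eq_zform => i; rewrite mulr0 addr0.
  by rewrite E; ring.
have E2 : 3 * tr s alpha = (Q u)%:~R + (Q B)%:~R * T z z.
  by rewrite E1 Qu !trD tr_int !trM_int /trform !(intrD, intrM) ?rmorphXn /= Dt !expr2; ring.
have QB1 : 1 <= Q B.
  apply: zform_ge1 => //; apply: contra nQalpha => /forallP B0.
  have -> : alpha = (Q A)%:~R.
    by rewrite Dalpha -zform_intr; apply: eq_zform => i; rewrite (eqP (B0 i)) mul0r addr0.
  by rewrite -(rmorph_int (in_alg L)) rpredZ ?mem1v.
have Qu0 : 0 <= Q u by apply: zform_ge0.
have QB1' : 1 <= (Q B)%:~R :> rat by rewrite ler1z.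
have Qu0' : 0 <= (Q u)%:~R :> rat by rewrite ler0z.
have Tz0 := trform_ge0 s z realL.
have le_TB : T z z <= (Q B)%:~R * T z z by rewrite ler_peMl.
split=> [|m5 le_m]; first by rewrite E2; lra.
have QB_eq1 : Q B = 1.
  apply/eqP; rewrite eq_le QB1 andbT leNgt; apply/negP=> QB2.
  have : 2 <= (Q B)%:~R :> rat by rewrite (ler_int _ 2).
  move: (_%:~R) E2 Qu0' => b E2 Qu0' b2; nra.
have Qu2 : Q u <= 2.
  by rewrite -(ler_int rat); move: E2; rewrite QB_eq1 mul1r; lra.
pose p := P A B.
(* This is the value of [Q] at [2 A - p B], since [Q B = 1]. *)
have disc_ge0 : 0 <= 4 * Q A - p ^+ 2.
  have := zform_comb a A B (fun=> 0) 2 (- p) 0; rewrite -/p QB_eq1 => E.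
  suff <- : Q (fun i => A i * 2 + B i * - p + 0 * 0) = 4 * Q A - p ^+ 2 by apply: zform_ge0.
  by rewrite E; ring.
have disc0 : 4 * Q A = p ^+ 2.
  (* The right side is at most 8, so the nonnegative integer multiplied by 9 is 0. *)
  have : 9 * (4 * Q A - p ^+ 2) + (3 * p + 2 * t) ^+ 2 = 4 * Q u.
    by rewrite Qu QB_eq1 /p; ring.
  have := sqr_ge0 (3 * p + 2 * t); lia.
exists (2%:~R * z + p%:~R); first by apply: in_OKD (in_OKZ _ _) (in_OK_int _ _).
rewrite E1 QB_eq1 -/p; transitivity ((4 * Q A)%:~R + 4 * z ^+ 2 + 4 * p%:~R * z).
  by rewrite intrM; ring.
by rewrite disc0 rmorphXn /=; ring.
Qed.

Lemma represented_bounds y w alpha (v : 'I_r -> L) :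
  in_OK y -> in_OK w -> y \notin 1%VS -> w \notin (1 + <[y]>)%VS ->
  (forall z, in_OK z -> z \notin 1%VS -> T y y <= T z z) ->
  T y y <= T w w -> 2 * `|T y w| <= T y y ->
  (forall z, in_OK z -> exists a b c : int, z = a%:~R + b%:~R * y + c%:~R * w) ->
  alpha \notin 1%VS -> (forall i, in_OK (v i)) -> zform_eval a v = alpha ->
  T y y <= 3 * tr s alpha /\
  (5 <= T y y -> 3 * tr s alpha <= T y y + 2 -> exists2 x, in_OK x & 4 * alpha = x ^+ 2).
Proof.
move=> Oy Ow nQy nUw min_y le_yw le_yw2 basisP nQalpha Ov Dalpha.
have nUshift (e : int) : w + e%:~R * y \notin 1%VS.
  apply: contra nUw => Q1; rewrite -[w](addrK (e%:~R * y)) rpredB //.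
    exact: (subvP (addvSl _ _)).
  rewrite -(rmorph_int (in_alg L)) mulr_algl rpredZ //.
  by rewrite memvE addvSr.
have nQw : w \notin 1%VS by have := nUshift 0; rewrite mul0r addr0.
have [A [B [C Dv]]] : exists A B C : 'I_r -> int,
    forall i, v i = (A i)%:~R + (B i)%:~R * y + (C i)%:~R * w.
  have [F DF] : exists F : 'I_r -> int * int * int,
      forall i, v i = (F i).1.1%:~R + (F i).1.2%:~R * y + (F i).2%:~R * w.
    apply: (@fin_all_exists 'I_r (fun=> (int * int * int)%type)
      (fun i p => v i = p.1.1%:~R + p.1.2%:~R * y + p.2%:~R * w)) => i.
    by have [x1 [x2 [x3 Dx]]] := basisP _ (Ov i); exists (x1, x2, x3).
  by exists (fun i => (F i).1.1), (fun i => (F i).1.2), (fun i => (F i).2).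
have {Dalpha}Dalpha : alpha = zform_eval a (fun i => (A i)%:~R + (B i)%:~R * y + (C i)%:~R * w).
  by rewrite -Dalpha; apply: eq_zform.
have rank1 B' z : in_OK z -> z \notin 1%VS ->
    (forall i, (B i)%:~R * y + (C i)%:~R * w = (B' i)%:~R * z) ->
    T y y <= 3 * tr s alpha /\
    (5 <= T y y -> 3 * tr s alpha <= T y y + 2 -> exists2 x, in_OK x & 4 * alpha = x ^+ 2).
  move=> Oz nQz E; apply: (@short_rank1_square A B' z) => //; first exact: min_y.
  by rewrite Dalpha; apply: eq_zform => i; rewrite -addrA E.
(* The four cases where one of [B], [C], [B - C], [B + C] vanishes: all coordinates then lie in the
   span of 1 and a single [z], namely [w], [y], [w + y] or [w - y]. *)
have [/forallP B0 | nzB] := boolP [forall i, B i == 0].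
  by apply: (rank1 C w) => // i; rewrite (eqP (B0 i)) mul0r add0r.
have [/forallP C0 | nzC] := boolP [forall i, C i == 0].
  by apply: (rank1 B y) => // i; rewrite (eqP (C0 i)) mul0r addr0.
have [/forallP BC | nBC] := boolP [forall i, B i - C i == 0].
  apply: (rank1 C (w + 1%:~R * y)) => // [|i]; first exact: in_OKD (in_OKZ _ _).
  by have := BC i; rewrite subr_eq0 => /eqP->; ring.
have [/forallP BC | nBC'] := boolP [forall i, B i + C i == 0].
  apply: (rank1 C (w + (-1)%:~R * y)) => // [|i]; first exact: in_OKD (in_OKZ _ _).
  by have /eqP := BC i; move/(canRL (addrK _)); rewrite add0r => ->; rewrite intrN; ring.
have [[tb Db] [tc Dc]] := (in_OK_tr Oy, in_OK_tr Ow).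
have E2 := tr_zform_integral_comb A B C Db Dc; rewrite -Dalpha in E2.
have := zform_ge1 posQ nzB; have := zform_ge1 posQ nzC.
have := zform_ge1 posQ nBC; have := zform_ge1 posQ nBC'.
have sum_eq (e : int) : Q (fun i => B i + e * C i) = Q B + e * P B C + e ^+ 2 * Q C.
  transitivity (Q (fun i => B i * 1 + C i * e + 0 * 0)).
    by apply: eq_zform => i; ring.
  by rewrite (zform_comb a B C (fun=> 0)); ring.
have -> : Q (fun i => B i + C i) = Q B + P B C + Q C.
  by have := sum_eq 1; rewrite !mul1r => <-; apply: eq_zform => i; rewrite mul1r.
have -> : Q (fun i => B i - C i) = Q B - P B C + Q C.
  by have := sum_eq (-1); rewrite sqrrN !mulN1r mul1r => <-; apply: eq_zform => i; rewrite mulN1r.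
have := zform_ge0 posQ (fun i => A i * 3 + B i * tb + C i * tc).
rewrite -!(ler_int rat) !intrD intrN => Qu0 h1 h2 h3 h4.
have Ty0 := trform_gt0 s realL nQy.
(* Once [T y y >= 5], this exceeds [T y y + 2], so no square has to be produced. This is the origin
   of the threshold 5. *)
have main : 3 / 2 * T y y <= 3 * tr s alpha by rewrite E2; apply: reduced_tensor_ge.
by split=> [|? ?]; lra.
Qed.

End Representation.

(** * Elimination of the cubic polynomials *)

(* [X^3 - t X^2 + q X - n] is the characteristic polynomial of [y]; the third and fourth hypotheses
   are the constraints that universality puts on [k + e * y], totally positive either because its
   trace is large or because its characteristic polynomial has alternating signs. *)
Lemma cubic_coefficients (t q n : int) :
  (t = 0 \/ t = 1) -> 0 < 2 * t ^+ 2 - 6 * q ->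
  (forall k e : int, e = 1 \/ e = -1 -> 0 < 3 * k + e * t ->
     4 * t ^+ 2 - 12 * q < (3 * k + e * t) ^+ 2 -> 2 * t ^+ 2 - 6 * q <= 3 * (3 * k + e * t)) ->
  (forall k e : int, e = 1 \/ e = -1 ->
     0 <= 3 * k + e * t -> 0 <= 3 * k ^+ 2 + 2 * k * e * t + q ->
     0 < k ^+ 3 + k ^+ 2 * e * t + k * q + e * n ->
     2 * t ^+ 2 - 6 * q <= 3 * (3 * k + e * t) /\
     (5 <= 2 * t ^+ 2 - 6 * q -> 3 * (3 * k + e * t) <= 2 * t ^+ 2 - 6 * q + 2 ->
      exists N : int, 64 * (k ^+ 3 + k ^+ 2 * e * t + k * q + e * n) = N ^+ 2)) ->
  (forall k : int, k ^+ 3 - t * k ^+ 2 + q * k - n != 0) ->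
  0 <= t ^+ 2 * q ^+ 2 - 4 * q ^+ 3 - 4 * t ^+ 3 * n + 18 * t * q * n - 27 * n ^+ 2 ->
  [/\ t = 1, q = -2 & n = -1].
Proof.
(* [64 * 3 = 192] lies between the squares of 13 and 14, and [64 * 5 = 320] between those of 17 and
   18. *)
have non_square (c N : int) : c = 3 \/ c = 5 -> 64 * c = N ^+ 2 -> False.
  move=> c35; rewrite -(real_normK (num_real N)); have : 0 <= `|N| by [].
  move: `|N| => M M0 DM.
  have [M13 | [[M14 M17] | M18]] : M <= 13 \/ (14 <= M /\ M <= 17) \/ 18 <= M by lia.
  - have : M ^+ 2 <= 169 by nia.
    lia.
  - have : 196 <= M ^+ 2 by nia.
    have : M ^+ 2 <= 289 by nia.
    lia.
  - have : 324 <= M ^+ 2 by nia.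
    lia.
move=> [-> | ->] T0 shift small root disc.
  (* With [t = 0] the bound on the trace [3 k] is [3 k >= - 2 q]. The largest multiple of 3 below
     [- 2 q] violates it, yet is large enough for total positivity. *)
  have q_ge : -5 < q.
    rewrite ltNge; apply/negP=> q_le; pose k := ((- 2 * q - 1) %/ 3)%Z.
    have [k1 k2] : - 2 * q - 3 <= 3 * k /\ 3 * k <= - 2 * q - 1 by rewrite /k; lia.
    have := shift k 1 (or_introl erefl); rewrite !mulr0 !addr0.
    have [q5 | q6] : q = - 5 \/ q <= - 6 by lia.
      have -> : k = 3 by lia.
      by rewrite q5; lia.
    have : 4 * 0 ^+ 2 - 12 * q < (3 * k) ^+ 2 by nia.
    lia.
  (* For each remaining [q] the discriminant bounds [n] or a small element is excluded directly;
     most cases have a rational root. *)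
  have [? | [? | [? | ?]]] : q = -1 \/ q = -2 \/ q = -3 \/ q = -4 by lia.
  - subst q; have n0 : n = 0 by move: disc; nia.
    by have := root 0; rewrite n0.
  - subst q; have [n0 | [n0 | n0]] : n = 0 \/ n = 1 \/ n = -1 by move: disc; nia.
    + by have := root 0; rewrite n0.
    + by have := root (-1); rewrite n0.
    + by have := root 1; rewrite n0.
  - subst q; have : n = 0 \/ n = 1 \/ n = -1 \/ n = 2 \/ n = -2 by move: disc; nia.
    move=> [|[|[|[|]]]] n0; subst n.
    + by have := root 0.
    (* Discriminant 81: [2 + y], or [2 - y] in the next case, has norm 3 and trace 6, while
       [T y = 18]. *)
    + have [] := small 2 1 (or_introl erefl) isT isT isT.
      by move=> _ /(_ isT isT)[N DN]; case: (non_square 3 N (or_introl erefl) DN).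
    + have [] := small 2 (-1) (or_intror erefl) isT isT isT.
      by move=> _ /(_ isT isT)[N DN]; case: (non_square 3 N (or_introl erefl) DN).
    + by have := root 2.
    + by have := root 1.
  - subst q; have [n0 | [n0 | n0]] : n = 0 \/ 0 < n \/ n < 0 by lia.
    + by have := root 0; rewrite n0.
    (* [2 + y], or [2 - y] for negative [n], has norm [|n|] and trace 6, below [T y / 3 = 8]. *)
    + have [] := small 2 1 (or_introl erefl); lia.
    + have [] := small 2 (-1) (or_intror erefl); lia.
have q_ge : -4 < q.
  rewrite ltNge; apply/negP=> q_le.
  (* Traces of [k + e y] are the integers prime to 3; the one chosen is the largest not exceeding
     [- 2 q], below the required [(2 - 6 q) / 3]. *)
  have [k [e [e1 ke]]] : exists k e : int, (e = 1 \/ e = -1) /\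
      (3 * k + e = - 2 * q \/ (3 * k + e = - 2 * q - 1 /\ q <= -6)).
    pose k := (- 2 * q %/ 3)%Z.
    have [h | [h | h]] : - 2 * q = 3 * k \/ - 2 * q = 3 * k + 1 \/ - 2 * q = 3 * k + 2.
      by rewrite /k; lia.
    - by exists k, (-1); lia.
    - by exists k, 1; lia.
    - by exists (k + 1), (-1); lia.
  have := shift k e e1; rewrite !mulr1.
  have -> : (4 * 1 ^+ 2 - 12 * q < (3 * k + e) ^+ 2).
    by case: ke => [-> | [-> ?]]; nia.
  lia.
have [? | [? | [? | ?]]] : q = 0 \/ q = -1 \/ q = -2 \/ q = -3 by lia.
- subst q; have n0 : n = 0 by move: disc; nia.
  by have := root 0; rewrite n0.
- subst q; have [n0 | n0] : n = 0 \/ n = -1 by move: disc; nia.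
  + by have := root 0; rewrite n0.
  + by have := root 1; rewrite n0.
- subst q; have [n0 | [n0 | n0]] : n = 0 \/ n = -1 \/ n = -2 by move: disc; nia.
  + by have := root 0; rewrite n0.
  (* Discriminant 49, the surviving polynomial. *)
  + by [].
  + by have := root 1; rewrite n0.
- subst q; have : n = 0 \/ n = 1 \/ n = -1 \/ n = -2 \/ n = -3 by move: disc; nia.
  move=> [|[|[|[|]]]] n0; subst n.
  + by have := root 0.
  + by have := root (-1).
  (* Discriminant 148: [2 + y] has norm 5 and trace 7, while [T y = 20]. *)
  + have [] := small 2 1 (or_introl erefl) isT isT isT.
    by move=> _ /(_ isT isT)[N DN]; case: (non_square 5 N (or_intror erefl) DN).
  + by have := root 2.
  + by have := root 1.
Qed.

(** With [z^-1 = z^6], expanding and reducing exponents modulo 7 turns the cubic into the sum of all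
    seventh roots of unity. *)
Lemma cubic_of_zeta7 (z : algC) (c := z + z^-1) : 7.-primitive_root z ->
  c ^+ 3 + c ^+ 2 - 2 * c - 1 = 0.
Proof.
move=> prim_z; have z7 : z ^+ 7 = 1 := prim_expr_order prim_z.
have -> : c = z + z ^+ 6.
  have nz_z : z != 0.
    by apply: contraTneq isT => z0; move/eqP: z7; rewrite z0 expr0n eq_sym oner_eq0.
  by rewrite /c -[z^-1]mulr1 -z7 [z ^+ 7]exprS mulKf.
have z1 : z - 1 != 0.
  by rewrite subr_eq0; have := eq_prim_root_expr prim_z 1 0; rewrite expr1 expr0 => ->.
have sum0 : 1 + z + z ^+ 2 + z ^+ 3 + z ^+ 4 + z ^+ 5 + z ^+ 6 = 0.
  by apply: (mulfI z1); rewrite mulr0; transitivity (z ^+ 7 - 1); [ring | rewrite z7 subrr].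
rewrite -sum0.
have e12 : z ^+ 12 = z ^+ 5 by rewrite (exprD z 7 5) z7 mul1r.
have e18 : z ^+ 18 = z ^+ 4 by rewrite (exprD z 14 4) (exprM z 7 2) z7 expr1n mul1r.
have e8 : z ^+ 8 = z by rewrite (exprD z 7 1) z7 mul1r.
have e13 : z ^+ 13 = z ^+ 6 by rewrite (exprD z 7 6) z7 mul1r.
transitivity (z ^+ 18 + 3 * z ^+ 13 + 3 * z ^+ 8 + z ^+ 3 + z ^+ 12 + 2 * z ^+ 7 + z ^+ 2
  - 2 * z - 2 * z ^+ 6 - 1); first by ring.
by rewrite e12 e18 e8 e13 z7; ring.
Qed.

(** * Integral characteristic polynomials and total positivity *)

Section IntegralVieta.

Variables (L : fieldExtType rat) (s : conjugates L).
Implicit Types (x y : L) (t q n : int).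

Definition int_vieta x t q n : Prop := vieta s x t%:~R q%:~R n%:~R.

Lemma int_vietaE x t q n : int_vieta x t q n <->
  [/\ conj1 s x + conj2 s x + conj3 s x = t%:~R,
      conj1 s x * conj2 s x + conj1 s x * conj3 s x + conj2 s x * conj3 s x = q%:~R
    & conj1 s x * conj2 s x * conj3 s x = n%:~R].
Proof. by rewrite /int_vieta /vieta !ratr_int. Qed.

Lemma int_vieta_affine (k e : int) x t q n : int_vieta x t q n ->
  int_vieta (k%:~R + e%:~R * x) (3 * k + e * t) (3 * k ^+ 2 + 2 * k * e * t + e ^+ 2 * q)
    (k ^+ 3 + k ^+ 2 * e * t + k * e ^+ 2 * q + e ^+ 3 * n).
Proof.
move=> /int_vietaE[Dt Dq Dn]; apply/int_vietaE.
rewrite !(intrD, intrM, rmorphD, rmorphM) ?rmorphXn /= !rmorph_int -Dt -Dq -Dn.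
by split; ring.
Qed.

Lemma int_vieta_no_root x t q n (k : int) : int_vieta x t q n -> x \notin 1%VS ->
  k ^+ 3 - t * k ^+ 2 + q * k - n != 0.
Proof.
move=> /int_vietaE[Dt Dq Dn]; apply: contra => /eqP/(congr1 (intr : int -> algC)).
rewrite !(rmorphB, rmorphD, rmorphM, rmorphXn) /= -Dt -Dq -Dn => /eqP.
have -> : k%:~R * (k%:~R * k%:~R) - (conj1 s x + conj2 s x + conj3 s x) * (k%:~R * k%:~R)
    + (conj1 s x * conj2 s x + conj1 s x * conj3 s x + conj2 s x * conj3 s x) * k%:~R
    - conj1 s x * conj2 s x * conj3 s x =
    (conj1 s x - k%:~R) * (conj2 s x - k%:~R) * (conj3 s x - k%:~R) * -1 by ring.
have rat_x (f : {rmorphism L -> algC}) : f x - k%:~R = 0 -> x \in 1%VS.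
  move/subr0_eq; rewrite -(rmorph_int f) => /fmorph_inj->.
  by rewrite -(rmorph_int (in_alg L)) rpredZ ?mem1v.
rewrite !mulf_eq0 oppr_eq0 oner_eq0 orbF -orbA => /or3P[] /eqP; exact: rat_x.
Qed.

Lemma integral_affine (k e : int) x : e = 1 \/ e = -1 -> in_OK x -> x \notin 1%VS ->
  in_OK (k%:~R + e%:~R * x) /\ k%:~R + e%:~R * x \notin 1%VS.
Proof.
move=> e1 Ox nQx; split; first exact: in_OKD (in_OK_int _ _) (in_OKZ _ _).
apply: contra nQx; rewrite -!(rmorph_int (in_alg L)) mulr_algl rpredDl;
  last by rewrite rpredZ ?mem1v.
by case: e1 => ->; rewrite ?rmorphN1 ?scaleN1r ?rpredN ?scale1r.
Qed.

Hypothesis realL : totally_real L.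

(** The discriminant is the square of the product of the differences of the real conjugates. *)
Lemma int_vieta_disc x t q n : int_vieta x t q n ->
  0 <= t ^+ 2 * q ^+ 2 - 4 * q ^+ 3 - 4 * t ^+ 3 * n + 18 * t * q * n - 27 * n ^+ 2.
Proof.
move=> /int_vietaE[Dt Dq Dn]; rewrite -(ler0z algC).
rewrite !(rmorphB, rmorphD, rmorphM, rmorphXn) /= -Dt -Dq -Dn.
set u := conj1 s x; set v := conj2 s x; set w := conj3 s x.
have : 0 <= ((u - v) * (u - w) * (v - w)) ^+ 2.
  by rewrite -realEsqr !rpredM ?rpredB ?realL.
by congr (0 <= _); ring.
Qed.

(** With alternating signs the characteristic polynomial is negative at every nonpositive real, so
    it has no root there. *)
Lemma totally_positive_coefs x t q n :
  int_vieta x t q n -> 0 <= t -> 0 <= q -> 0 < n -> totally_positive x.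
Proof.
move=> Dx t0 q0 n0 f; have := congr1 f (vieta_root Dx).
rewrite rmorph0 !(rmorphB, rmorphD) /= !rmorphZ_num rmorph1 !rmorphXn !ratr_int mulr1 => E.
have fx_real := realL f x.
rewrite real_ltNge ?real0 //; apply/negP=> fx_le0.
have : f x ^+ 3 - t%:~R * f x ^+ 2 + q%:~R * f x - n%:~R < 0.
  have sq0 : 0 <= f x ^+ 2 by rewrite -realEsqr.
  rewrite subr_lt0; apply: (@le_lt_trans _ _ 0); last by rewrite ltr0z.
  rewrite -addrA -oppr_ge0 opprD addr_ge0 //.
    by rewrite exprS -mulNr mulr_ge0 ?oppr_ge0.
  rewrite opprD opprK; apply: addr_ge0; last by rewrite oppr_ge0 mulr_ge0_le0 ?ler0z.
  by rewrite mulr_ge0 ?ler0z.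
by rewrite E ltxx.
Qed.

(* With the conjugates [r, r', r''] of [x], [(r' - r'') ^+ 2 >= 0] reads
   [(3 * r - t) ^+ 2 <= 4 * t ^+ 2 - 12 * q]. *)
Lemma totally_positive_affine x t q n (k e : int) :
  int_vieta x t q n -> e = 1 \/ e = -1 -> 0 < 3 * k + e * t ->
  4 * t ^+ 2 - 12 * q < (3 * k + e * t) ^+ 2 -> totally_positive (k%:~R + e%:~R * x).
Proof.
move=> /int_vietaE[Dt Dq Dn] e1 m_gt0 lt_m f.
have realf (g : {rmorphism L -> algC}) : g x \is Num.real := realL g x.
have le_fx : (3 * f x - t%:~R) ^+ 2 <= (4 * t ^+ 2 - 12 * q)%:~R.
  rewrite !(rmorphB, rmorphD, rmorphM, rmorphXn) /= -Dt -Dq -subr_ge0.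
  set u := conj1 s x; set v := conj2 s x; set w := conj3 s x.
  have sq_ge0 (g h : {rmorphism L -> algC}) : 0 <= 3 * (g x - h x) ^+ 2.
    by rewrite mulr_ge0 ?ler0n // -realEsqr rpredB.
  have [->|->|->] := conjP s f x.
  - by have := sq_ge0 (conj2 s) (conj3 s); congr (0 <= _); rewrite -/u -/v -/w; ring.
  - by have := sq_ge0 (conj1 s) (conj3 s); congr (0 <= _); rewrite -/u -/v -/w; ring.
  - by have := sq_ge0 (conj1 s) (conj2 s); congr (0 <= _); rewrite -/u -/v -/w; ring.
(* Three times the conjugate of [k + e x] is its trace plus [d], and [d] is smaller than that trace
   in absolute value. *)
pose d := e%:~R * (3 * f x - t%:~R) : algC.
have real_d : d \is Num.real by rewrite !(rpredM, rpredB) ?realz ?rpred_nat ?realf.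
have lt_d : d ^+ 2 < ((3 * k + e * t) ^+ 2)%:~R.
  apply: le_lt_trans (_ : (4 * t ^+ 2 - 12 * q)%:~R < _); last by rewrite ltr_int.
  by rewrite exprMn; case: e1 => ->; rewrite ?rmorphN1 ?sqrrN expr1n mul1r.
have -> : f (k%:~R + e%:~R * x) = ((3 * k + e * t)%:~R + d) / 3.
  by rewrite rmorphD rmorphM /= !rmorph_int /d intrD !intrM; field.
rewrite divr_gt0 ?ltr0n //; move: lt_d; rewrite rmorphXn /=.
have real_m : (3 * k + e * t)%:~R \is @Num.real algC by apply: realz.
rewrite -(real_normK real_d) ltr_sqr ?nnegrE ?normr_ge0 ?ler0z ?ltW //.
by rewrite real_ltr_norml // => /andP[lt_d _]; rewrite -ltrBlDl sub0r.
Qed.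

End IntegralVieta.

(** * Identification of the field and normalization of the minimizer *)

Lemma iso_to_Qadj_generator (L : fieldExtType rat) (f : {rmorphism L -> algC}) (x : L) :
  \dim {: L} = 3%N -> x \notin 1%VS -> iso_to_Qadj L (f x).
Proof.
move=> dim3 nQx; have [_ gen_x] := adjoin_cubic dim3 nQx.
have f_horner (p : {poly rat}) : f (map_poly (in_alg L) p).[x] = (map_poly ratr p).[f x].
  rewrite -horner_map -map_poly_comp; congr _.[_]; apply: eq_map_poly => a /=.
  by rewrite rmorphZ_num rmorph1 mulr1.
exists f => z; split=> [[u <-] | [p ->]]; last by exists (map_poly (in_alg L) p).[x].
have /Fadjoin1_polyP[p ->] : u \in <<1; x>>%VS by rewrite gen_x memvf.
by exists p; rewrite f_horner.
Qed.

(** The number [- c] is a root of [X^3 - X^2 - 2 X + 1], hence a conjugate of [x], so [c] is the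
    image of the generator [- x]. *)
Lemma iso_to_Q_zeta7 (L : fieldExtType rat) (s : conjugates L) (x : L) (z : algC) :
  \dim {: L} = 3%N -> x \notin 1%VS -> int_vieta s x 1 (-2) (-1) ->
  7.-primitive_root z -> iso_to_Qadj L (z + z^-1).
Proof.
move=> dim3 nQx /int_vietaE[Dt Dq Dn] /cubic_of_zeta7; set c := z + z^-1 => Dc.
have : (- c - conj1 s x) * (- c - conj2 s x) * (- c - conj3 s x) = 0.
  transitivity (- c ^+ 3 - (conj1 s x + conj2 s x + conj3 s x) * c ^+ 2
    - (conj1 s x * conj2 s x + conj1 s x * conj3 s x + conj2 s x * conj3 s x) * c
    - conj1 s x * conj2 s x * conj3 s x); first by ring.
  by rewrite Dt Dq Dn -[RHS]oppr0 -Dc; ring.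
have conj_c (f : {rmorphism L -> algC}) : - c - f x = 0 -> iso_to_Qadj L c.
  move/subr0_eq => Ec; have -> : c = f (- x) by rewrite rmorphN -Ec opprK.
  by apply: iso_to_Qadj_generator; rewrite ?rpredN.
move/eqP; rewrite !mulf_eq0 -orbA => /or3P[] /eqP; exact: conj_c.
Qed.

(** Translation by rational integers and change of sign preserve [T]; they shift the trace by
    multiples of 3 and negate it. *)
Lemma exists_normalized_minimizer (L : fieldExtType rat) (s : conjugates L) :
  \dim {: L} = 3%N -> totally_real L ->
  exists y (t q n : int), [/\ in_OK y, y \notin 1%VS,
    forall z, in_OK z -> z \notin 1%VS -> trform s y y <= trform s z z,
    int_vieta s y t q n & t = 0 \/ t = 1].
Proof.
move=> dim3 realL.
have [|y [Oy nQy min_y]] := exists_trform_minimizer s realL (U := 1%VS).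
  by apply/negP=> /dimvS; rewrite dim3 dimv1.
have [t [q [n Dy]]] := in_OK_vieta s Oy.
have [k [e [e1 te]]] : exists k e : int, (e = 1 \/ e = -1) /\
    (3 * k + e * t = 0 \/ 3 * k + e * t = 1).
  have [k] : exists k : int, t = 3 * k \/ t = 3 * k + 1 \/ t = 3 * k + 2.
    by exists (t %/ 3)%Z; lia.
  move=> [->|[->|->]].
  - by exists (- k), 1; split; [left | left; ring].
  - by exists (- k), 1; split; [left | right; ring].
  - by exists (k + 1), (-1); split; [right | right; ring].
exists (k%:~R + e%:~R * y), (3 * k + e * t), (3 * k ^+ 2 + 2 * k * e * t + e ^+ 2 * q),
  (k ^+ 3 + k ^+ 2 * e * t + k * e ^+ 2 * q + e ^+ 3 * n).
have [Oy' nQy'] := integral_affine k e1 Oy nQy.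
split=> //; last exact: int_vieta_affine.
have Dy' := int_vieta_affine k e Dy.
move=> z Oz nQz; apply: le_trans (min_y z Oz nQz).
rewrite (vieta_trform Dy) (vieta_trform Dy') le_eqVlt; apply/orP; left; apply/eqP.
by rewrite !(rmorphD, rmorphM, rmorphXn) /=; case: e1 => ->; ring.
Qed.

(** Take norms: that of [4 * alpha] is [64 * n]. *)
Lemma int_vieta_square (L : fieldExtType rat) (s : conjugates L) (x alpha : L) (t q n : int) :
  in_OK x -> int_vieta s alpha t q n -> 4 * alpha = x ^+ 2 -> exists N : int, 64 * n = N ^+ 2.
Proof.
move=> /(in_OK_vieta s)[t' [q' [N Dx]]] /int_vietaE[_ _ Dn] E; exists N.
have [_ _ DN] := (int_vietaE _ _ _ _ _).1 Dx.
have conjE (f : {rmorphism L -> algC}) : 4 * f alpha = f x ^+ 2.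
  by rewrite -rmorphXn -E rmorphM rmorph_nat.
apply: (@intr_inj algC); rewrite rmorphM rmorphXn /= -Dn -DN !exprMn -!conjE; ring.
Qed.

Theorem theorem4p1 (L : fieldExtType rat) (z7 : algC) :
  \dim {: L} = 3%N ->
  totally_real L ->
  7.-primitive_root z7 ->
  ~ iso_to_Qadj L (z7 + z7^-1) ->
  ~ (exists (r : nat) (a : 'I_r -> 'I_r -> int), pos_def a /\ universal_over_OK L a).
Proof.
move=> dim3 realL prim_z7 not_K49 [r [a [posQ univ]]].
have [c1 [c2 [c3 c_rat]]] := three_embeddings dim3.
pose s := Conjugates c_rat.
have [y [t [q [n [Oy nQy min_y Dy t01]]]]] := exists_normalized_minimizer s dim3 realL.
have [w [Ow nUw le_yw le_yw2 basisP]] := exists_reduced_basis realL dim3 Oy nQy min_y.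
(* Universality enters only here, through a representation of [k + e y]; the bounds are then cast
   from rationals to integers. *)
have key (k e : int) (e1 : e = 1 \/ e = -1) :
    totally_positive (k%:~R + e%:~R * y) ->
    2 * t ^+ 2 - 6 * q <= 3 * (3 * k + e * t) /\
    (5 <= 2 * t ^+ 2 - 6 * q -> 3 * (3 * k + e * t) <= 2 * t ^+ 2 - 6 * q + 2 ->
     exists2 x, in_OK x & 4 * (k%:~R + e%:~R * y) = x ^+ 2).
  have [Oalpha nQalpha] := integral_affine k e1 Oy nQy.
  move=> /(univ _ Oalpha)[v [Ov Dv]].
  have := represented_bounds realL posQ Oy Ow nQy nUw min_y le_yw le_yw2 basisP nQalpha Ov Dv.
  rewrite (vieta_tr (int_vieta_affine k e Dy)) (vieta_trform Dy).
  have -> : 2 * t%:~R ^+ 2 - 6 * q%:~R = (2 * t ^+ 2 - 6 * q)%:~R :> rat by ring.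
  have -> : 3 * (3 * k + e * t)%:~R = (3 * (3 * k + e * t))%:~R :> rat by rewrite intrM.
  by rewrite (ler_int _ 5) -(intrD _ _ 2) !ler_int.
have [t1 q2 n1] : [/\ t = 1, q = -2 & n = -1].
  apply: cubic_coefficients => //.
  - have := trform_gt0 s realL nQy; rewrite (vieta_trform Dy).
    have -> : 2 * t%:~R ^+ 2 - 6 * q%:~R = (2 * t ^+ 2 - 6 * q)%:~R :> rat by ring.
    by rewrite ltr0z.
  - move=> k e e1 m_gt0 lt_m.
    by have [] := key k e e1 (totally_positive_affine realL Dy e1 m_gt0 lt_m).
  - move=> k e e1 A0 B0 C0; have Dalpha := int_vieta_affine k e Dy.
    have ee : e ^+ 2 = 1 by case: e1 => ->.
    have DC : k ^+ 3 + k ^+ 2 * e * t + k * e ^+ 2 * q + e ^+ 3 * n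
      = k ^+ 3 + k ^+ 2 * e * t + k * q + e * n by rewrite (exprS e 2) ee !mulr1.
    rewrite DC ee mul1r in Dalpha.
    have [bound square] := key k e e1 (totally_positive_coefs realL Dalpha A0 B0 C0).
    split=> // T5 small; have [x Ox Dx] := square T5 small.
    exact: int_vieta_square Ox Dalpha Dx.
  - by move=> k; apply: int_vieta_no_root Dy nQy.
  - have := int_vieta_disc realL Dy; lia.
apply: not_K49; rewrite t1 q2 n1 in Dy.
exact: iso_to_Q_zeta7 dim3 nQy Dy prim_z7.
Qed.
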